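(* Let $(X,d)$ be an $\mathcal{F}$-metric space, equipped with its $\mathcal{F}$-metric topology $\tau_{\mathcal{F}}$. Then $(X,\tau_{\mathcal{F}})$ is first countable.
   Context: Let $\mathcal{F}$ be the set of functions $f:[0,\infty)\to\mathbb{R}$ such that: ($\mathcal{F}_1$) $f$ is non-decreasing, i.e. $0<s<t\Rightarrow f(s)\le f(t)$; ($\mathcal{F}_2$) for every sequence $\{t_n\}\subseteq(0,\infty)$, $\lim_{n\to\infty}t_n=0 \iff \lim_{n\to\infty}f(t_n)=-\infty$. Let $X$ be a non-empty set and $d:X\times X\to[0,\infty)$ a map. Then $d$ is an $\mathcal{F}$-metric on $X$, and $(X,d)$ is an $\mathcal{F}$-metric space, if there exists $(f,\alpha)\in\mathcal{F}\times[0,\infty)$ such that: (D1) for all $x,y\in X$, $d(x,y)=0\iff x=y$; (D2) $d(x,y)=d(y,x)$ for all $x,y\in X$; (D3) for every $(x,y)\in X\times X$, every $N\in\mathbb{N}$ with $N\ge 2$, and every $(u_i)_{i=1}^N\subseteq X$ with $(u_1,u_N)=(x,y)$, we have $d(x,y)>0\Rightarrow f(d(x,y))\le f\big(\sum_{i=1}^{N-1}d(u_i,u_{i+1})\big)+\alpha$. For $x\in X$ and $r>0$ put $B(x,r)=\{y\in X: d(x,y)<r\}$. A set $U\subseteq X$ is $\mathcal{F}$-open if for every $x\in U$ there is $r>0$ with $B(x,r)\subseteq U$; the $\mathcal{F}$-open sets form the topology $\tau_{\mathcal{F}}$ on $X$. *)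

(* Defs.v *)
From HB Require Import structures.
From mathcomp Require Import all_boot all_order all_algebra.
From mathcomp Require Import all_classical all_reals all_analysis.

Set Implicit Arguments.
Unset Strict Implicit.
Unset Printing Implicit Defensive.

Import Order.TTheory GRing.Theory Num.Theory.
Import numFieldNormedType.Exports.

Local Open Scope classical_set_scope.
Local Open Scope ring_scope.

Record class_F (R : realType) (f : {nonneg R} -> R) : Prop := ClassF {
  class_F1 : forall s t : {nonneg R}, 0 < s%:num -> s%:num < t%:num -> f s <= f t;
  class_F2 : forall t : nat -> {nonneg R}, (forall n, 0 < (t n)%:num) ->
    ((t n)%:num @[n --> \oo] --> (0 : R) <-> f (t n) @[n --> \oo] --> -oo)
}.

Lemma chain_sum_ge0 (R : realType) (X : Type) (d : X -> X -> {nonneg R})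
  (u : nat -> X) (N : nat) : 0 <= \sum_(1 <= i < N) (d (u i) (u i.+1))%:num.
Proof. exact: sumr_ge0. Qed.

Definition chain_sum (R : realType) (X : Type) (d : X -> X -> {nonneg R})
  (u : nat -> X) (N : nat) : {nonneg R} := NngNum (chain_sum_ge0 d u N).

(* In the chain condition only the values u 1, ..., u N of u are used. *)
Definition is_F_metric (R : realType) (X : Type) (d : X -> X -> {nonneg R}) : Prop :=
  exists (f : {nonneg R} -> R) (alpha : {nonneg R}),
    [/\ class_F f,
        forall x y, (d x y)%:num = 0 <-> x = y,
        forall x y, d x y = d y x &
        forall (x y : X) (N : nat) (u : nat -> X),
          (2 <= N)%N -> u 1%N = x -> u N = y -> 0 < (d x y)%:num ->
          f (d x y) <= f (chain_sum d u N) + alpha%:num].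

Definition F_ball (R : realType) (X : Type) (d : X -> X -> {nonneg R})
  (x : X) (r : R) : set X := [set y | (d x y)%:num < r].

Definition F_open (R : realType) (X : Type) (d : X -> X -> {nonneg R}) : set (set X) :=
  [set U | forall x, U x -> exists2 r : R, 0 < r & F_ball d x r `<=` U].

(* Copy of X carrying the topology whose open sets are the F-open sets. The
   F-open sets form a topology for any d, so no F-metric axiom is needed here. *)
Definition F_space (R : realType) (X : Type) (d : X -> X -> {nonneg R}) : Type := X.

Section F_topology.
Context (R : realType) (X : Type) (d : X -> X -> {nonneg R}).

Let F_openT : F_open d setT.
Proof. by move=> x _; exists 1. Qed.

Let F_openI (A B : set X) : F_open d A -> F_open d B -> F_open d (A `&` B).
Proof.
move=> oA oB x [/oA[r r0 rA] /oB[s s0 sB]]; exists (Num.min r s).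
  by rewrite lt_min r0 s0.
by move=> y; rewrite /F_ball /= lt_min => /andP[yr ys]; split; [exact: rA|exact: sB].
Qed.

Let F_open_bigU (I : Type) (A : I -> set X) :
  (forall i, F_open d (A i)) -> F_open d (\bigcup_i A i).
Proof.
move=> oA x [i _ /oA[r r0 rA]]; exists r => // y /rA Ay.
by exists i.
Qed.

HB.instance Definition _ := gen_eqMixin (F_space d).
HB.instance Definition _ := gen_choiceMixin (F_space d).
HB.instance Definition _ :=
  isOpenTopological.Build (F_space d) F_openT F_openI F_open_bigU.

Lemma F_space_openE : @open (F_space d) = F_open d.
Proof. by []. Qed.

End F_topology.

Definition first_countable (T : topologicalType) : Prop :=
  forall x : T, exists B : set (set T),
    [/\ countable B, B `<=` open_nbhs x & filter_from B id --> x].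

(* Main.v *)
Require Import Defs.
From mathcomp Require Import all_boot all_order all_algebra.
From mathcomp Require Import all_classical all_reals all_analysis.

(** An F-ball need not be F-open. But the set of points reached from [x] by
    chains of total length less than [r] is F-open, since each of its points
    leaves some room to extend the chain by one step. The chain condition (D3),
    together with [f t --> -oo] as [t --> 0], shows that these sets for
    [r = 1 / (n + 1)] are eventually contained in every F-ball centred at [x]. *)

Set Implicit Arguments.
Unset Strict Implicit.
Unset Printing Implicit Defensive.

Import Order.TTheory GRing.Theory Num.Theory.
Import numFieldNormedType.Exports.

Local Open Scope classical_set_scope.
Local Open Scope ring_scope.

(** Applied to the harmonic sequence, (F2) gives one index with value of [f] below [M]; monotonicity
    carries this bound to all smaller positive arguments. *)
Lemma class_F_lt_near0 (R : realType) (f : {nonneg R} -> R) (M : R) :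
  class_F f ->
  exists2 e : R, 0 < e & forall t : {nonneg R}, 0 < t%:num < e -> f t < M.
Proof.
move=> [f_ndecr f_cvg].
have inv_ge0 n : 0 <= n.+1%:R^-1 :> R by rewrite invr_ge0.
pose t n : {nonneg R} := NngNum (inv_ge0 n).
have t_gt0 n : 0 < (t n)%:num by rewrite /= invr_gt0.
have /(f_cvg t t_gt0)/cvgrNy_lt/(_ M)[n _ /(_ n (leqnn n)) ftn] :
  (t n)%:num @[n --> \oo] --> (0 : R) by exact: cvg_harmonic.
exists (t n)%:num => // s /andP[s0 sn].
exact: le_lt_trans (f_ndecr _ _ s0 sn) ftn.
Qed.

Definition chain_ball (R : realType) (X : Type) (d : X -> X -> {nonneg R})
    (x : X) (r : R) : set X :=
  [set y | exists (u : nat -> X) (N : nat),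
     [/\ (2 <= N)%N, u 1%N = x, u N = y & (chain_sum d u N)%:num < r]].

Lemma chain_ball_center (R : realType) (X : Type) (d : X -> X -> {nonneg R})
    (x : X) (r : R) : (d x x)%:num < r -> chain_ball d x r x.
Proof. by move=> dr; exists (fun=> x), 2%N; split; rewrite //= big_nat1. Qed.

Lemma chain_ball_F_open (R : realType) (X : Type) (d : X -> X -> {nonneg R})
  (x : X) (r : R) : F_open d (chain_ball d x r).
Proof.
move=> y [u [N [N2 u1 uN ur]]]; exists (r - (chain_sum d u N)%:num).
  by rewrite subr_gt0.
move=> z; rewrite /F_ball /= => yz.
(* The values of [u] beyond [N] are arbitrary, so they are overwritten by the new endpoint [z]. *)
exists (fun i => if (i <= N)%N then u i else z), N.+1.
split; [exact: leqW|by rewrite (ltnW N2)|by rewrite ltnn|].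
rewrite /= big_nat_recr ?(ltnW N2)//= leqnn ltnn uN addrC -ltrBrDr.
rewrite (eq_big_nat _ _ (F2 := fun i => (d (u i) (u i.+1))%:num))//.
by move=> i /andP[_ iN]; rewrite iN (ltnW iN).
Qed.

(** A vanishing sum of nonnegative steps forces every step to vanish. This rules out chains of
    length 0, where [f] is not controlled. *)
Lemma chain_sum_eq0 (R : realType) (X : Type) (d : X -> X -> {nonneg R})
    (u : nat -> X) (N : nat) :
  (forall x y, (d x y)%:num = 0 -> x = y) -> (1 <= N)%N ->
  (chain_sum d u N)%:num = 0 -> u 1%N = u N.
Proof.
move=> d0; elim: N => [//|[//|N] IH] _ /=.
rewrite big_nat_recr//= => /eqP; rewrite paddr_eq0 ?sumr_ge0//.
by move=> /andP[/eqP /(IH isT) -> /eqP/d0].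
Qed.

Lemma chain_ball_sub_F_ball (R : realType) (X : Type)
    (d : X -> X -> {nonneg R}) (r : R) :
  is_F_metric d -> 0 < r ->
  exists2 e : R, 0 < e & forall x, chain_ball d x e `<=` F_ball d x r.
Proof.
move=> [f [alpha [fF d0 _ D3]]] r0.
(* This threshold makes the right-hand side of (D3) smaller than [f r] for every chain of positive
   length below [e], whatever its starting point. *)
have [e e0 fe] := class_F_lt_near0 (f (NngNum (ltW r0)) - alpha%:num) fF.
exists e => // x y [u [N [N2 u1 uN ue]]]; rewrite /F_ball /= ltNge.
apply/negP => rxy; have xy0 := lt_le_trans r0 rxy.
have sum_gt0 : 0 < (chain_sum d u N)%:num.
  rewrite lt_neqAle eq_sym ge0 andbT; apply/eqP => sum0.
  have xy : x = y.
    by rewrite -u1 -uN; apply: chain_sum_eq0 sum0; [move=> ? ? /d0|exact: ltnW].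
  by move: xy0; rewrite (d0 x y).2// ltxx.
have f_lt : f (d x y) < f (NngNum (ltW r0)).
  apply: le_lt_trans (D3 x y N u N2 u1 uN xy0) _.
  by rewrite -ltrBrDr fe// sum_gt0.
(* (F1) compares only strictly ordered arguments, so [d x y = r] is treated apart. *)
move: rxy; rewrite le_eqVlt => /orP[/eqP rE|rxy].
  have E : d x y = NngNum (ltW r0) by apply/val_inj; rewrite /= -rE.
  by rewrite E ltxx in f_lt.
by have := class_F1 fF (s := NngNum (ltW r0)) r0 rxy; rewrite leNgt f_lt.
Qed.

Theorem theorem2p3 (R : realType) (X : Type) (X_neq0 : [set: X] !=set0)
  (d : X -> X -> {nonneg R}) (d_metric : is_F_metric d) :
  first_countable (F_space d).
Proof.
move=> x; pose B (n : nat) : set (F_space d) := chain_ball d x n.+1%:R^-1.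
exists (range B); split.
- exact/card_image_le.
- move=> _ [n _ <-]; split; first exact: chain_ball_F_open.
  apply: chain_ball_center.
  by case: d_metric => f [alpha [_ /(_ x x)[_ ->//] _ _]]; rewrite invr_gt0.
- move=> A; rewrite nbhsE => -[U [oU Ux] UA].
  (* Open sets of [F_space d] are by definition the F-open ones. *)
  have [r r0 rU] : exists2 r : R, 0 < r & F_ball d x r `<=` U by exact: oU.
  have [e e0 eball] := chain_ball_sub_F_ball d_metric r0.
  have [n ne] : exists n : nat, n.+1%:R^-1 < e.
    have /cvgr_lt/(_ e e0)[n _ /(_ n (leqnn n)) ne] := @cvg_harmonic R.
    by exists n.
  exists (B n); first by exists n.
  move=> y [u [N [N2 u1 uN ur]]]; apply/UA/rU/eball.
  by exists u, N; split=> //; exact: lt_trans ur ne.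
Qed.
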